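(* For any integer $s\geq 1$, $f_{SD}(s)=\lceil (s+1)/2\rceil$ and $\lceil (s-1)/2\rceil\le f_D(s)\le\lceil s/2\rceil$.
   Context: All graphs are finite, simple and undirected. For an integer $d\geq 1$, $\mathbb{S}^{d-1}\subset\mathbb{R}^d$ denotes the sphere of radius $1/\sqrt{2}$ centred at the origin. A graph $G=(V,E)$ can be realized as a unit distance graph in a subset $X\subseteq\mathbb{R}^d$ if there is an injective map $\phi\colon V\to X$ such that $|\phi(x)-\phi(y)|=1$ (Euclidean distance) for every edge $xy\in E$; non-adjacent vertices may also be mapped to points at distance $1$. $\overline{G}$ denotes the complement of $G$. $f_D(s)$ denotes the smallest possible $d$ such that for any graph $G$ on $s$ vertices, either $G$ or $\overline{G}$ (or both) can be realized as a unit distance graph in $\mathbb{R}^d$. $f_{SD}(s)$ denotes the smallest possible $d$ such that for any graph $G$ on $s$ vertices, either $G$ or $\overline{G}$ (or both) can be realized as a unit distance graph in $\mathbb{S}^{d-1}$.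
   Formalization: The equality for f_SD(s) is proved for all s ≥ 1 except s = 2, where it fails: the sphere S^0 has two points and any graph on 2 vertices or its complement is edgeless, so f_SD(2) = 1, not 2; the bounds on f_D(s) are proved for every s ≥ 1. *)

(* Defs.v *)
From HB Require Import structures.
From mathcomp Require Import all_boot all_order all_algebra.
From mathcomp Require Import boolp classical_sets reals.
Set Implicit Arguments.
Unset Strict Implicit.
Unset Printing Implicit Defensive.
Import Order.TTheory GRing.Theory Num.Theory.
Local Open Scope ring_scope.

Record sgraph (V : finType) := SGraph {
  edge :> rel V;
  edge_sym : symmetric edge;
  edge_irrefl : irreflexive edge }.

Definition compl_edge (V : finType) (G : sgraph V) : rel V :=
  fun x y => (x != y) && ~~ G x y.

Lemma compl_edge_sym (V : finType) (G : sgraph V) : symmetric (compl_edge G).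
Proof. by move=> x y; rewrite /compl_edge eq_sym edge_sym. Qed.

Lemma compl_edge_irrefl (V : finType) (G : sgraph V) :
  irreflexive (compl_edge G).
Proof. by move=> x; rewrite /compl_edge eqxx. Qed.

Definition complement (V : finType) (G : sgraph V) : sgraph V :=
  SGraph (compl_edge_sym G) (compl_edge_irrefl G).

(* The library norm on 'rV[R]_d is the sup norm, so the Euclidean one is
   defined here. *)
Definition enorm (R : realType) (d : nat) (x : 'rV[R]_d) : R :=
  Num.sqrt (\sum_(i < d) x 0 i ^+ 2).

(* S^{d-1}, indexed by the dimension d of the ambient space.  For d = 1 it
   consists of two points, at distance sqrt 2 from each other: it contains the
   edgeless graph on two vertices, so that f_SD R 2 = 1. *)
Definition sphere (R : realType) (d : nat) : set 'rV[R]_d :=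
  [set x | enorm x = 1 / Num.sqrt 2]%classic.

Definition unit_distance_in (R : realType) (d : nat) (X : set 'rV[R]_d)
    (V : finType) (G : sgraph V) : Prop :=
  exists phi : V -> 'rV[R]_d,
    [/\ injective phi,
        forall x, X (phi x) &
        forall x y, G x y -> enorm (phi x - phi y) = 1].

Definition ramsey_in (R : realType) (d : nat) (X : set 'rV[R]_d) (s : nat) :
    Prop :=
  forall (V : finType) (G : sgraph V), #|V| = s ->
    unit_distance_in X G \/ unit_distance_in X (complement G).

(* Any graph on s vertices lives on s vectors of an orthogonal basis. *)
Lemma ramsey_in_sphere (R : realType) (s : nat) :
  ramsey_in (@sphere R s.+1) s.
Proof.
move=> V G cV; left.
have lt_rk (v : V) : (enum_rank v < s.+1)%N by rewrite ltnS -cV ltnW.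
pose r v : 'I_s.+1 := Ordinal (lt_rk v).
have r_inj : injective r by move=> u v [] /ord_inj /enum_rank_inj.
pose c : R := 1 / Num.sqrt 2.
have c0 : c != 0 by rewrite /c mul1r invr_eq0 sqrtr_eq0 -ltNge ltr0n.
have c2 : c ^+ 2 = 2^-1 by rewrite /c mul1r exprVn sqr_sqrtr ?ler0n.
have c_ge0 : 0 <= c by rewrite /c mul1r invr_ge0 sqrtr_ge0.
pose phi v : 'rV[R]_s.+1 := \row_i (c *+ (i == r v)).
exists phi; split.
- move=> u v /rowP/(_ (r u)); rewrite !mxE eqxx.
  by case: eqP => [/r_inj //|_] /eqP; rewrite mulr0n (negbTE c0).
- move=> u; rewrite /sphere /= /enorm (bigD1 (r u)) //= big1 => [|i ne].
    by rewrite !mxE eqxx addr0 sqrtr_sqr ger0_norm.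
  by rewrite !mxE (negbTE ne) mulr0n expr0n.
move=> u v Guv; have ne : r v != r u.
  by apply: contraTneq Guv => /r_inj ->; rewrite edge_irrefl.
rewrite /enorm (bigD1 (r u)) //= (bigD1 (r v)) //= big1 => [|i /andP[iu iv]].
  rewrite !mxE !eqxx (negbTE ne) eq_sym (negbTE ne) !mulr0n subr0 sub0r sqrrN.
  by rewrite addr0 !mulr1n c2 -mulr2n -[_ *+ 2]mulr_natl divff ?sqrtr1 ?pnatr_eq0.
by rewrite !mxE (negbTE iu) (negbTE iv) !mulr0n subr0 expr0n.
Qed.

Lemma f_D_exists (R : realType) (s : nat) :
  exists d, (0 < d)%N && `[< ramsey_in [set: 'rV[R]_d]%classic s >].
Proof.
exists s.+1; apply/asboolP => V G /(@ramsey_in_sphere R s V G).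
by case=> -[phi [inj _ dist]]; [left|right]; exists phi.
Qed.

Lemma f_SD_exists (R : realType) (s : nat) :
  exists d, (0 < d)%N && `[< ramsey_in (@sphere R d) s >].
Proof. by exists s.+1; apply/asboolP/ramsey_in_sphere. Qed.

Definition f_D (R : realType) (s : nat) : nat := ex_minn (f_D_exists R s).

Definition f_SD (R : realType) (s : nat) : nat := ex_minn (f_SD_exists R s).

(* Main.v *)
Require Import Defs.
From mathcomp Require Import all_boot all_order all_algebra.
From mathcomp Require Import reals.
From mathcomp Require Import boolp zify ring lra.

(** Two vectors of squared norm 1/2 are at distance 1 exactly when they are
orthogonal.  Realizing a graph on the sphere in dimension d thus means giving
its vertices distinct vectors of squared norm 1/2, orthogonal for adjacent
vertices.  Write d = k + 1, and let e and f be complementary edge relations.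

Upper bounds.  A vertex with fewer than k neighbours can be added to any
spherical embedding, since the vectors orthogonal to its neighbours contain a
plane ([sph_embed_add]).  Hence only the k-cores matter: the subset H where e
has minimum degree at least k, and the subset K where f has
([peeling]).  A core is embedded by opposite pairs on orthogonal axes: two
vertices that are not adjacent may share an axis, so K embeds for f as soon as
e has a matching of size |K| - d on K ([matching_sph_embed]).

Such a matching is found on the intersection W of H and K, where the degrees
for e and f are both large but add up to |W| - 1.  Put h = |H \ K| and assume
h >= |K \ H|.  If H and K together have at most 2k + 1 vertices, then e has
minimum degree at least k - h on W, and |W| >= 2(k - h), which yields a
matching of size k - h ([mindeg_matching]); this is exactly what K needs
([odd_cores_embed]), and f is realized on the sphere.

If H and K together have 2k + 2 = 2d vertices, one more edge is needed, and
the degrees on W for e take only the values k - h and k - h + 1.  A matching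
that cannot be enlarged then has a rigid structure
([near_regular_matching]).  Either e has the larger matching, or f has a
matching good enough to embed e on H, or f is complete on K with |K| = d + 1
and some vertex v of K has all its f-neighbours in K ([even_cores_embed]).  In
this last case f - v is realized on the sphere, with the d neighbours of v on
orthogonal axes, and v is placed off the sphere on the line through the origin
and their sum ([off_sphere_embed]).

Lower bounds.  Take a clique on all but t of the s vertices.  With t = d - 1
and s >= 2d, the clique contains d + 1 pairwise orthogonal vectors, which do
not exist.  In the complement, t vertices are pairwise orthogonal and
orthogonal to all others, which therefore lie on one line: at most two points
([codim1_two_points]).  In the whole space the same argument with t = d and
s >= 2d + 2 applies after moving one vertex to the origin, the vectors then
having the inner product 1/2 instead of 0 ([gram_row_free]). *)

Set Implicit Arguments.
Unset Strict Implicit.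
Unset Printing Implicit Defensive.
Import Order.TTheory GRing.Theory Num.Theory.

(** * Cores and matchings *)

Section Graph.
Variable T : finType.
Implicit Types (e f : rel T) (A B W H : {set T}) (x y z u v : T).

Definition nbrs e A x := [set y in A | e x y].

Lemma nbrsS e A B x : A \subset B -> nbrs e A x \subset nbrs e B x.
Proof.
move=> sAB; apply/subsetP => y; rewrite !inE => /andP[yA ->].
by rewrite (subsetP sAB).
Qed.

Lemma in_nbrs e A x y : (y \in nbrs e A x) = (y \in A) && e x y.
Proof. by rewrite inE. Qed.

Lemma card_nbrs e A x : #|nbrs e A x| = \sum_(y in A) e x y.
Proof.
rewrite -sum1_card; under eq_bigl => y do rewrite inE.
by rewrite big_mkcondr; apply: eq_bigr => y _; case: (e x y).
Qed.

(** The k-core of A is what remains after deleting vertices of degree less than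
k as long as there are any.  Putting them back in the reverse order gives an
induction principle: a property that survives adding a vertex with fewer than k
neighbours passes from the core to A. *)
Lemma peeling e k A :
  exists H : {set T}, [/\ H \subset A,
    forall x, x \in H -> k <= #|nbrs e H x| &
    forall P : {set T} -> Prop,
      (forall B x, x \notin B -> #|nbrs e B x| < k -> P B -> P (x |: B)) ->
      P H -> P A].
Proof.
elim/ltn_ind: {A}#|A| {-2}A (erefl #|A|) => n IHn A cA.
have [/forall_inP Adeg|] := boolP [forall x in A, k <= #|nbrs e A x|].
  by exists A => //; split.
rewrite negb_forall_in => /exists_inP[x xA]; rewrite -ltnNge => ltxk.
have sDA := subsetDl A [set x].
have ltc : #|A :\ x| < n by rewrite -cA [#|A|](cardsD1 x) xA.
have [H [sH Hdeg HP]] := IHn _ ltc _ erefl.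
exists H; split=> [|//|P]; first exact: subset_trans sH sDA.
move=> Pstep PH; rewrite -(setD1K xA).
apply: Pstep (HP P Pstep PH); first by rewrite !inE eqxx.
exact: leq_ltn_trans (subset_leq_card (nbrsS e x sDA)) ltxk.
Qed.

(** A matching that covers exactly A is an involution that sends each vertex of A
to its partner and fixes the others. *)
Definition matches e A (p : T -> T) :=
  involutive p /\ forall x, if x \in A then e x (p x) else p x == x.

Definition matched e A := exists p, matches e A p.

Definition has_matching e W m :=
  exists A : {set T}, [/\ A \subset W, matched e A & #|A| = m.*2].

Section Matching.
Variables (e : rel T) (e_sym : symmetric e) (e_irr : irreflexive e).

Lemma matches_closed A p x : matches e A p -> (p x \in A) = (x \in A).
Proof.
case=> pK pA; move: (pA x) (pA (p x)); rewrite pK.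
have [xA|xA] := boolP (x \in A); have [pxA|pxA] := boolP (p x \in A) => //.
  by move=> exp /eqP xp; move: exp; rewrite -xp e_irr.
by move=> /eqP ->; rewrite e_irr.
Qed.

Lemma matches_neq A p x : matches e A p -> x \in A -> p x != x.
Proof.
by case=> _ /(_ x) + xA; rewrite xA => ex; apply: contraTneq ex => ->; rewrite e_irr.
Qed.

Lemma matched_sub A B p :
  matches e A p -> B \subset A -> (forall x, x \in B -> p x \in B) ->
  matched e B.
Proof.
move=> [pK pA] sBA pB.
exists (fun x => if x \in B then p x else x); split=> x.
  by have [xB|xB] := boolP (x \in B); rewrite ?pB ?pK // (negbTE xB).
by have := pA x; have [/(subsetP sBA) -> //|] := boolP (x \in B).
Qed.

Lemma matched_add A x y :
  matched e A -> x \notin A -> y \notin A -> e x y -> matched e (x |: (y |: A)).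
Proof.
move=> [p mp] xA yA exy; have [pK pA] := mp.
have xy : x != y by apply: contraTneq exy => ->; rewrite e_irr.
exists (fun z => if z == x then y else if z == y then x else p z); split=> z /=.
  have [->|zx] := eqVneq z x; first by rewrite eqxx eq_sym (negbTE xy).
  have [->|zy] := eqVneq z y; first by rewrite eqxx.
  have px : p x = x by apply/eqP; have := pA x; rewrite (negbTE xA).
  have py : p y = y by apply/eqP; have := pA y; rewrite (negbTE yA).
  by rewrite -{1}px -{2}py !(inj_eq (can_inj pK)) (negbTE zx) (negbTE zy) pK.
rewrite !inE; have [->//|zx] := eqVneq z x.
by have [->/=|zy] := eqVneq z y; [rewrite e_sym | apply: pA].
Qed.

Lemma matched0 : matched e set0.
Proof. by exists id; split=> x //; rewrite inE. Qed.

(** In this section p is a matching of size m in W that cannot be enlarged.  An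
augmenting path between two uncovered vertices is thus impossible, whether it has
one, two or three edges outside the matching. *)
Section Stuck.
Variables (W A : {set T}) (p : T -> T) (m : nat).
Hypotheses (sAW : A \subset W) (mp : matches e A p) (cA : #|A| = m.*2).
Hypothesis stuck : ~ has_matching e W m.+1.
Let U := W :\: A.

Let mA : matched e A. Proof. by exists p. Qed.

Lemma stuck_indep x y : x \in U -> y \in U -> ~~ e x y.
Proof.
rewrite !inE => /andP[xA xW] /andP[yA yW]; apply/negP => exy.
have xy : x != y by apply: contraTneq exy => ->; rewrite e_irr.
case: stuck; exists (x |: (y |: A)); split.
- by rewrite !subUset !sub1set xW yW.
- exact: matched_add.
- by rewrite !cardsU1 !inE negb_or xy xA yA cA doubleS.
Qed.

Lemma stuck_aug2 z x y :
  z \in A -> x \in U -> y \in U -> x != y -> e z x -> e (p z) y -> False.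
Proof.
rewrite !inE => zA /andP[xA xW] /andP[yA yW] xy ezx ezy.
have pzA : p z \in A by rewrite (matches_closed _ mp).
have pz := matches_neq mp zA; have [pK _] := mp.
pose B := A :\ z :\ p z.
have sBA : B \subset A by rewrite /B; apply/subsetP => t; rewrite !inE => /and3P[].
have mB : matched e B.
  apply: matched_sub mp sBA _ => t; rewrite !inE => /and3P[tpz tz tA].
  rewrite (matches_closed _ mp) tA (inj_eq (can_inj pK)) tz.
  by rewrite -(inj_eq (can_inj pK)) pK tpz.
have zx : z != x by apply: contraNneq xA => <-.
have pzx : p z != x by apply: contraNneq xA => <-.
have zy : z != y by apply: contraNneq yA => <-.
have pzy : p z != y by apply: contraNneq yA => <-.
case: stuck; exists (z |: (x |: (p z |: (y |: B)))); split.
- by rewrite !subUset !sub1set xW yW !(subsetP sAW) ?(subset_trans sBA).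
- have yB : y \notin B by rewrite !inE (negbTE yA) !andbF.
  have pzB : p z \notin B by rewrite !inE eqxx.
  have zB : z \notin p z |: (y |: B).
    by rewrite !inE eqxx andbF !orbF negb_or eq_sym pz.
  have xB : x \notin p z |: (y |: B).
    by rewrite !inE (negbTE xA) !andbF orbF negb_or xy eq_sym pzx.
  by apply: matched_add => //; apply: matched_add.
- rewrite !cardsU1 !inE !eqxx (negbTE xA) (negbTE yA) !andbF !orbF /=.
  rewrite (negbTE zx) (negbTE zy) [z == _]eq_sym [x == _]eq_sym (negbTE pz).
  rewrite (negbTE pzx) (negbTE xy) (negbTE pzy) /=.
  have cB : #|A| = #|B|.+2.
    by rewrite (cardsD1 z A) (cardsD1 (p z) (A :\ z)) -/B !inE pz pzA zA.
  by rewrite doubleS -cA cB.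
Qed.

Lemma stuck_aug3 z t x y :
  z \in A -> t \in A -> t != p z -> e z t ->
  x \in U -> y \in U -> x != y -> e (p z) x -> e (p t) y -> False.
Proof.
rewrite !inE => zA tA tpz ezt /andP[xA xW] /andP[yA yW] xy ezx ety.
have zt : z != t by apply: contraTneq ezt => ->; rewrite e_irr.
have pzA : p z \in A by rewrite (matches_closed _ mp).
have ptA : p t \in A by rewrite (matches_closed _ mp).
have pz := matches_neq mp zA; have pt := matches_neq mp tA; have [pK _] := mp.
have ptz : p t != z by rewrite -(inj_eq (can_inj pK)) pK.
have pzpt : p z != p t by rewrite (inj_eq (can_inj pK)).
pose B := A :\ z :\ p z :\ t :\ p t.
have sBA : B \subset A by apply/subsetP => s; rewrite !inE => /and5P[].
have mB : matched e B.
  apply: matched_sub mp sBA _ => s; rewrite !inE => /and5P[spt st spz sz sA].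
  rewrite (matches_closed _ mp) sA !(inj_eq (can_inj pK)) sz st.
  by rewrite -!(inj_eq (can_inj pK) (p s)) !pK spz spt.
have nex s w : s \in A -> w \notin A -> s != w by move=> sA; apply: contraNneq => <-.
have ne1 := (nex _ _ zA xA, nex _ _ tA xA, nex _ _ pzA xA, nex _ _ ptA xA).
have ne2 := (nex _ _ zA yA, nex _ _ tA yA, nex _ _ pzA yA, nex _ _ ptA yA).
have cB : #|A| = #|B|.+4.
  rewrite (cardsD1 z A) (cardsD1 (p z) (A :\ z)) (cardsD1 t (A :\ z :\ p z)).
  rewrite (cardsD1 (p t) (A :\ z :\ p z :\ t)) -/B !inE zA pzA tA ptA pz.
  by rewrite (eq_sym t z) zt tpz pt eq_sym pzpt ptz.
case: stuck; exists (x |: (p z |: (y |: (p t |: (z |: (t |: B)))))); split.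
- by rewrite !subUset !sub1set xW yW !(subsetP sAW) ?(subset_trans sBA).
- have tB : t \notin B by rewrite !inE eqxx /= andbF.
  have zB : z \notin B by rewrite !inE eqxx !andbF.
  have ptB : p t \notin z |: (t |: B).
    by rewrite !inE eqxx !orbF negb_or ptz pt.
  have yB : y \notin z |: (t |: B).
    by rewrite !inE (negbTE yA) !andbF orbF negb_or ![y == _]eq_sym !ne2.
  have pzB : p z \notin y |: (p t |: (z |: (t |: B))).
    by rewrite !inE eqxx !andbF !orbF !negb_or ne2 pzpt pz (eq_sym _ t) tpz.
  have xB : x \notin y |: (p t |: (z |: (t |: B))).
    by rewrite !inE (negbTE xA) !andbF orbF !negb_or xy ![x == _]eq_sym !ne1.
  apply: matched_add => //; last by rewrite e_sym.
  apply: matched_add => //; last by rewrite e_sym.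
  exact: matched_add.
- rewrite !cardsU1 !inE !eqxx (negbTE xA) (negbTE yA) !andbF !orbF /= !negb_or.
  rewrite ![x == _]eq_sym ![y == _]eq_sym !ne1 !ne2 pzpt pz ptz pt zt.
  rewrite xy (eq_sym (p z) t) tpz /=.
  by rewrite doubleS -cA cB.
Qed.

Lemma stuck_nbrs u : u \in U -> nbrs e W u = nbrs e A u.
Proof.
move=> uU; apply/setP => z; rewrite !inE.
have [eu|] := boolP (e u z); rewrite ?andbT ?andbF //.
have [zA|zA] := boolP (z \in A); first exact: (subsetP sAW).
apply/negP => zW; have zU : z \in U by rewrite inE zA zW.
by move: eu; rewrite (negbTE (stuck_indep uU zU)).
Qed.

(** If z and its partner both have uncovered neighbours, these must all be the
same vertex, for otherwise [stuck_aug2] applies; and 2 <= |U|. *)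
Lemma stuck_pair z :
  z \in A -> 1 < #|U| -> #|nbrs e U z| + #|nbrs e U (p z)| <= #|U|.
Proof.
move=> zA U1.
have sub w : #|nbrs e U w| <= #|U|.
  by apply/subset_leq_card/subsetP => x; rewrite inE => /andP[].
have [->|[x]] := set_0Vmem (nbrs e U z); first by rewrite cards0 sub.
rewrite inE => /andP[xU ezx].
have [->|[y]] := set_0Vmem (nbrs e U (p z)); first by rewrite cards0 addn0 sub.
rewrite inE => /andP[yU ezy].
have uni w w' : w \in U -> w' \in U -> e z w -> e (p z) w' -> w = w'.
  move=> wU w'U ew ew'; apply/eqP/negP => /negP ne.
  exact: stuck_aug2 zA wU w'U ne ew ew'.
apply: leq_trans (_ : 1 + 1 <= _) => //; apply: leq_add.
  rewrite -(cards1 y); apply/subset_leq_card/subsetP => w.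
  by rewrite !inE => /andP[/andP[wA wW] ew]; apply/eqP/uni => //; rewrite inE wA.
rewrite -(cards1 x); apply/subset_leq_card/subsetP => w.
by rewrite !inE => /andP[/andP[wA wW] ew]; rewrite eq_sym; apply/eqP/uni => //; rewrite inE wA.
Qed.

(** The edges between U and the covered vertices, counted twice: from U, and from
each edge of the matching twice, once at each end. *)
Lemma stuck_count :
  (\sum_(u in U) #|nbrs e W u|).*2 =
  \sum_(z in A) (#|nbrs e U z| + #|nbrs e U (p z)|).
Proof.
have pinj : injective p by case: mp => /can_inj.
have sumpA : \sum_(z in A) #|nbrs e U (p z)| = \sum_(z in A) #|nbrs e U z|.
  rewrite [RHS](reindex_inj pinj) /=; apply: eq_bigl => z.
  by rewrite (matches_closed _ mp).
rewrite big_split /= sumpA addnn; congr _.*2.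
under eq_bigr => u uU do rewrite stuck_nbrs // card_nbrs.
under [RHS]eq_bigr => z _ do rewrite card_nbrs.
rewrite exchange_big; apply: eq_bigr => z _; apply: eq_bigr => u _.
by rewrite e_sym.
Qed.

End Stuck.

(** A matching of size less than r leaves a set U of at least two vertices
uncovered.  At least r |U| edges leave U; if the matching is stuck, each of its
m edges receives at most |U| of them by [stuck_pair], whence m >= r. *)
Lemma mindeg_matching W r m :
  (forall x, x \in W -> r <= #|nbrs e W x|) -> r.*2 <= #|W| -> m <= r ->
  has_matching e W m.
Proof.
move=> degW cW; elim: m => [|m IHm] ltmr.
  by exists set0; rewrite sub0set cards0; split=> //; exact: matched0.
have [A [sAW [p mp] cA]] := IHm (ltnW ltmr).
have [//|stuck] := EM (has_matching e W m.+1).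
have cU : #|W :\: A| = #|W| - m.*2 by rewrite cardsDS ?cA.
have U1 : 1 < #|W :\: A| by move: cU cW ltmr; clear; lia.
have := stuck_count sAW mp cA stuck.
have : \sum_(z in A) (#|nbrs e (W :\: A) z| + #|nbrs e (W :\: A) (p z)|) <=
       #|A| * #|W :\: A|.
  by rewrite -sum_nat_const; apply: leq_sum => z zA; apply: stuck_pair stuck _ _ _.
have : #|W :\: A| * r <= \sum_(u in W :\: A) #|nbrs e W u|.
  rewrite -sum_nat_const; apply: leq_sum => u; rewrite inE => /andP[_].
  exact: degW.
rewrite cA => le1 le2 eq1; move: le2; rewrite -eq1 -doubleMl leq_double.
move=> /(leq_trans le1); rewrite mulnC leq_pmul2r ?(ltnW U1) //.
by rewrite leqNgt ltmr.
Qed.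

End Matching.

Lemma compl_sym e f : symmetric e -> irreflexive f ->
  (forall x y, x != y -> f x y = ~~ e x y) -> symmetric f.
Proof.
move=> e_sym f_irr fe x y; have [->//|xy] := eqVneq x y.
by rewrite !fe // 1?e_sym // eq_sym.
Qed.

Lemma card_nbrs_compl e f W x : irreflexive e -> irreflexive f ->
  (forall x y, x != y -> f x y = ~~ e x y) -> x \in W ->
  #|nbrs e W x| + #|nbrs f W x| = #|W|.-1.
Proof.
move=> e_irr f_irr fe xW; rewrite (cardsD1 x W) xW /=.
rewrite -cardsUI [_ :&: _](_ : _ = set0); last first.
  apply/setP => y; rewrite !inE; have [->|yx] := eqVneq y x.
    by rewrite e_irr andbF.
  by rewrite fe 1?eq_sym //; case: (e x y); rewrite ?andbF.
rewrite cards0 addn0; apply: eq_card => y; rewrite !inE.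
have [->|yx] := eqVneq y x; first by rewrite e_irr f_irr !andbF.
by rewrite fe 1?eq_sym //; case: (e x y); rewrite ?andbF ?andbT ?orbF.
Qed.

(** Let p be a matching of size r, covering A, that is stuck, and let U be the
uncovered set.  The count in [mindeg_matching] is then an equality: the vertices
of U have degree r, and each edge of p receives exactly |U| edges from U.  So
either one end of the edge is joined to all of U and the other end to none, or
both ends have the same single neighbour in U and |U| = 2.

An edge of the first kind leads to a contradiction: the ends without neighbour
in U are adjacent only to the r opposite ends X, so all of W outside X, which is
a' + 1 vertices, is joined to all of X, against the upper bound on degrees.  If
all edges are of the second kind, then either there is none, and r = 0, or
|U| = 2 and e splits W into two halves of size r + 1 with no edge between them,
so that f has minimum degree at least r + 1 = |W| / 2. *)
Lemma near_regular_matching e f W r a' :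
  symmetric e -> irreflexive e -> irreflexive f ->
  (forall x y, x != y -> f x y = ~~ e x y) ->
  (forall x, x \in W -> r <= #|nbrs e W x| <= r.+1) ->
  r < a' -> #|W| = r.+1 + a' ->
  [\/ has_matching e W r.+1,
      a' = r.+1 /\ has_matching f W a' |
      r = 0 /\ forall x y, x \in W -> y \in W -> ~~ e x y].
Proof.
move=> e_sym e_irr f_irr fe degW ltra' cW.
have minW x : x \in W -> r <= #|nbrs e W x| by case/degW/andP.
have [|stuck] := EM (has_matching e W r.+1); first by constructor 1.
have [A [sAW [p mp] cA]] : has_matching e W r.
  by apply: (mindeg_matching _ _ minW) => //; rewrite cW; move: ltra'; clear; lia.
have pK : involutive p by case: mp.
pose U := W :\: A; pose N z := #|nbrs e U z|.
have cU : #|U| = (a' - r).+1.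
  by rewrite cardsDS // cA cW; move: ltra'; clear; lia.
have U1 : 1 < #|U| by rewrite cU ltnS subn_gt0.
have UW u : u \in U -> u \in W by rewrite inE => /andP[].
have indU : forall x y, x \in U -> y \in U -> ~~ e x y.
  by move=> x y; apply: (stuck_indep _ _ sAW mp cA stuck).
(* The two sides of the double count agree, so each term is extremal. *)
have count := stuck_count e_sym e_irr sAW mp cA stuck; rewrite -/U -/N in count.
have pairA z : z \in A -> N z + N (p z) <= #|U|.
  by move=> zA; apply: (stuck_pair _ _ sAW mp cA stuck zA U1).
have leU : \sum_(u in U) r <= \sum_(u in U) #|nbrs e W u|.
  by apply: leq_sum => u /UW /minW.
have leA : \sum_(z in A) (N z + N (p z)) <= \sum_(z in A) #|U|.
  by apply: leq_sum => z zA; apply: pairA.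
have tot : (\sum_(u in U) r).*2 = \sum_(z in A) #|U|.
  by rewrite !sum_nat_const cA mulnC doubleMl.
have degU u : u \in U -> #|nbrs e W u| = r.
  have [_ eqU] := leqif_sum (fun u (uU : u \in U) => leqif_eq (minW u (UW u uU))).
  have : \sum_(u in U) r == \sum_(u in U) #|nbrs e W u|.
    by rewrite eqn_leq leU -leq_double count tot.
  by rewrite eqU => /forall_inP H /H /eqP.
have degA z : z \in A -> N z + N (p z) = #|U|.
  have [_ eqA] := leqif_sum (fun z zA => leqif_eq (pairA z zA)).
  have : \sum_(z in A) (N z + N (p z)) == \sum_(z in A) #|U|.
    by rewrite eqn_leq leA -count -tot leq_double.
  by rewrite eqA => /forall_inP H /H /eqP.
have NU z u : N z = #|U| -> u \in U -> e z u.
  move=> Nz uU; have sub : nbrs e U z \subset U.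
    by apply/subsetP => x; rewrite inE => /andP[].
  have /eqP E : nbrs e U z == U.
    by rewrite eqEcard sub -/(N z) Nz leqnn.
  by move: uU; rewrite -{1}E in_nbrs => /andP[].
have N0 z u : N z = 0 -> u \in U -> ~~ e z u.
  move=> /eqP; rewrite cards_eq0 => /eqP/setP/(_ u) + uU.
  by rewrite in_nbrs in_set0 uU /= => ->.
have pA z : (p z \in A) = (z \in A) by apply: matches_closed mp.
(* Here y is an end without neighbour in U, hence of an edge of the first kind. *)
have [/exists_inP[y yA /eqP y0]|] := boolP [exists y in A, N y == 0].
  pose X := [set z in A | N z == #|U|].
  have sub z : z \in A -> N z = 0 -> nbrs e W z \subset X.
    move=> zA z0; apply/subsetP => t; rewrite inE => /andP[tW ezt].
    have tA : t \in A.
      by apply: contraTT ezt => tA; apply: N0; rewrite ?inE ?tA.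
    have Npz : N (p z) = #|U| by have := degA z zA; rewrite z0.
    rewrite inE tA; have [->|tpz] := eqVneq t (p z); first by rewrite Npz eqxx.
    have [pt0|] := eqVneq (N (p t)) 0.
      by have := degA t tA; rewrite pt0 addn0 => ->; rewrite eqxx.
    rewrite cards_eq0 => /set0Pn[v]; rewrite in_nbrs => /andP[vU ev].
    have [u] : exists u, u \in U :\ v.
      by apply/set0Pn; rewrite -card_gt0; move: U1; rewrite (cardsD1 v) vU.
    rewrite inE in_set1 => /andP[uv uU].
    case: (stuck_aug3 e_sym e_irr sAW mp cA stuck zA tA tpz ezt uU vU uv) => //.
    exact: NU.
  have cX : #|X| <= r.
    rewrite -leq_double -cA -addnn -{2}(card_imset X (can_inj pK)) -cardsUI.
    have -> : X :&: [set p x | x in X] = set0.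
      apply/setP => z; rewrite !inE; apply/negP => /andP[/andP[_ /eqP zU]].
      move=> /imsetP[t]; rewrite inE => /andP[tA /eqP tU] ezt.
      by have := degA t tA; rewrite tU -ezt zU; move: U1; clear; lia.
    rewrite cards0 addn0; apply/subset_leq_card; rewrite subUset.
    apply/andP; split; apply/subsetP => z; first by rewrite inE => /andP[].
    by case/imsetP => t + ->; rewrite inE pA => /andP[].
  have eqX z : z \in A -> N z = 0 -> nbrs e W z = X.
    move=> zA z0; apply/eqP; rewrite eqEcard sub // (leq_trans cX) // minW //.
    exact: (subsetP sAW).
  have cXr : #|X| = r.
    by apply/eqP; rewrite eqn_leq cX -(eqX y) // minW // (subsetP sAW).
  have pyX : p y \in X.
    by rewrite inE pA yA; have := degA y yA; rewrite y0 add0n => ->; rewrite eqxx.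
  have pyW : p y \in W by rewrite (subsetP sAW) ?pA.
  have NpyU : N (p y) = #|U| by move: pyX; rewrite inE => /andP[_ /eqP].
  have : U :|: [set p x | x in X] \subset nbrs e W (p y).
    rewrite subUset; apply/andP; split; apply/subsetP => z.
      by move=> zU; rewrite in_nbrs UW //= NU.
    case/imsetP => x xX ->; move: (xX); rewrite inE => /andP[xA /eqP Nx].
    have Npx : N (p x) = 0 by have := degA x xA; rewrite Nx; clear; lia.
    rewrite inE (subsetP sAW) ?pA //= e_sym.
    by move: pyX; rewrite -(eqX (p x)) ?pA // inE => /andP[].
  move=> /subset_leq_card; rewrite cardsU [_ :&: _](_ : _ = set0); last first.
    apply/setP => z; rewrite !inE; apply/negP => /andP[/andP[zA _]].
    by case/imsetP => x + ez; rewrite inE => /andP[xA _]; rewrite ez pA xA in zA.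
  rewrite cards0 subn0 card_imset ?cXr ?cU; last exact: can_inj pK.
  have /andP[_] := degW _ pyW; move: ltra'; clear; lia.
rewrite negb_exists_in => /forall_inP Npos.
have [A0|[z zA]] := set_0Vmem A.
  constructor 3; split; first by move: cA; rewrite A0 cards0; clear; lia.
  by move=> x y xW yW; apply: indU; rewrite /U A0 setD0.
constructor 2.
(* All edges of the matching are now of the second kind, and there is one. *)
have single w : w \in A ->
    exists u, [/\ u \in U, nbrs e U w = [set u] & nbrs e U (p w) = [set u]].
  move=> wA; have := Npos _ wA; rewrite cards_eq0 => /set0Pn[u].
  rewrite in_nbrs => /andP[uU eu].
  have := Npos (p w); rewrite pA wA cards_eq0 => /(_ isT)/set0Pn[u'].
  rewrite in_nbrs => /andP[u'U eu'].
  have uni x y : x \in U -> y \in U -> e w x -> e (p w) y -> x = y.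
    move=> xU yU ex ey; apply/eqP/negP => /negP xy.
    exact: (stuck_aug2 e_sym e_irr sAW mp cA stuck wA xU yU xy ex ey).
  have uu' : u = u' by apply: uni.
  exists u; split=> //; apply/setP => x; rewrite in_nbrs in_set1.
    apply/idP/eqP => [/andP[xU ex]|->]; last by rewrite uU.
    by rewrite uu'; apply: uni.
  apply/idP/eqP => [/andP[xU ex]|->]; last by rewrite uU uu'.
  by rewrite -[x](uni u) // uu'.
have a'r : a' = r.+1.
  have := degA _ zA; have [u [_ Nz Npz]] := single _ zA.
  by rewrite /N Nz Npz !cards1 cU; move: ltra'; clear; lia.
split=> //.
have lowdeg v : v \in W -> #|nbrs e W v| <= r.
  move=> vW; have [vA|vA] := boolP (v \in A); last by rewrite degU // inE vA.
  have [u [uU Nv Npv]] := single v vA.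
  have [u2] : exists u2, u2 \in U :\ u.
    by apply/set0Pn; rewrite -card_gt0; move: U1; rewrite (cardsD1 u) uU.
  rewrite in_setD1 => /andP[u2u u2U].
  (* H2 is the half that does not contain v. *)
  pose H2 := u2 |: nbrs e W u2.
  have HW : H2 \subset W.
    rewrite subUset sub1set UW //=.
    by apply/subsetP => x; rewrite in_nbrs => /andP[].
  have cH : #|H2| = r.+1 by rewrite cardsU1 in_nbrs e_irr andbF /= degU.
  have nv : ~~ e v u2.
    have /setP/(_ u2) := Nv; rewrite in_nbrs in_set1 u2U (negbTE u2u) /=.
    by move=> ->.
  have vH : v \notin H2.
    rewrite in_setU1 in_nbrs vW /= e_sym (negbTE nv) orbF.
    by apply: contraTneq vA => ->; move: u2U; rewrite inE => /andP[].
  have sub : nbrs e W v \subset W :\: H2 :\ v.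
    apply/subsetP => t; rewrite in_nbrs => /andP[tW evt].
    rewrite in_setD1 in_setD tW andbT; apply/andP; split.
      by apply: contraTneq evt => ->; rewrite e_irr.
    rewrite in_setU1 in_nbrs tW /= negb_or; apply/andP; split.
      by apply: contraTneq evt => ->.
    apply/negP => eu2t.
    have tA : t \in A.
      by move: eu2t; apply: contraTT => tA; rewrite indU // inE tA.
    have [w [wU Nt Npt]] := single t tA.
    have wu2 : u2 = w.
      by apply/set1P; rewrite -Nt in_nbrs u2U e_sym.
    have epv : e (p v) u by have := set11 u; rewrite -Npv in_nbrs => /andP[].
    have ept : e (p t) u2.
      have : u2 \in nbrs e U (p t) by rewrite Npt wu2 set11.
      by rewrite in_nbrs => /andP[].
    have tpv : t != p v.
      apply: contraNneq u2u => tE; rewrite -in_set1 -Npv -tE in_nbrs u2U.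
      by rewrite e_sym.
    apply: (stuck_aug3 e_sym e_irr sAW mp cA stuck vA tA tpv evt uU u2U) => //.
    by rewrite eq_sym.
  have := subset_leq_card sub.
  have := cardsD1 v (W :\: H2); rewrite in_setD vH vW /= cardsDS // cH cW a'r.
  by clear; lia.
apply: (@mindeg_matching f _ f_irr W a') => //; last 1 first.
- by rewrite cW a'r addnn.
- exact: compl_sym e_sym f_irr fe.
move=> x xW; have := card_nbrs_compl e_irr f_irr fe xW.
by have := lowdeg x xW; rewrite cW a'r; clear; lia.
Qed.
End Graph.

Local Open Scope ring_scope.

(** * Inner products *)

Section Dot.
Variables (R : realType) (d : nat).
Implicit Types (u v w : 'rV[R]_d) (a : R).

Definition dot u v : R := (u *m v^T) 0 0.

Lemma dotE u v : dot u v = \sum_i u 0 i * v 0 i.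
Proof. by rewrite /dot mxE; apply: eq_bigr => i _; rewrite mxE. Qed.

Lemma dotC u v : dot u v = dot v u.
Proof. by rewrite !dotE; apply: eq_bigr => i _; rewrite mulrC. Qed.

Lemma dotDl u v w : dot (u + v) w = dot u w + dot v w.
Proof. by rewrite /dot mulmxDl mxE. Qed.

Lemma dotZl a u w : dot (a *: u) w = a * dot u w.
Proof. by rewrite /dot -scalemxAl mxE. Qed.

Lemma dotDr u v w : dot w (u + v) = dot w u + dot w v.
Proof. by rewrite !(dotC w) dotDl. Qed.

Lemma dotZr a u w : dot w (a *: u) = a * dot w u.
Proof. by rewrite !(dotC w) dotZl. Qed.

Lemma dotBl u v w : dot (u - v) w = dot u w - dot v w.
Proof. by rewrite -scaleN1r dotDl dotZl mulN1r. Qed.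

Lemma dotBr u v w : dot w (u - v) = dot w u - dot w v.
Proof. by rewrite !(dotC w) dotBl. Qed.

Lemma dot_suml (I : Type) (r : seq I) (P : pred I) (F : I -> 'rV[R]_d) w :
  dot (\sum_(i <- r | P i) F i) w = \sum_(i <- r | P i) dot (F i) w.
Proof. by rewrite /dot mulmx_suml summxE. Qed.

Lemma dot_ge0 u : 0 <= dot u u.
Proof. by rewrite dotE sumr_ge0 // => i _; rewrite -expr2 sqr_ge0. Qed.

Lemma dot_eq0 u : (dot u u == 0) = (u == 0).
Proof.
apply/eqP/eqP => [|->]; last by rewrite /dot mul0mx mxE.
rewrite dotE => /psumr_eq0P u0; apply/rowP => i; rewrite mxE; apply/eqP.
by rewrite -sqrf_eq0 expr2 u0 // => j _; rewrite -expr2 sqr_ge0.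
Qed.

Lemma dot_gt0 u : (0 < dot u u) = (u != 0).
Proof. by rewrite lt0r dot_ge0 dot_eq0 andbT. Qed.

Lemma enormE u : enorm u = Num.sqrt (dot u u).
Proof. by rewrite /enorm dotE; under eq_bigr do rewrite expr2. Qed.

Lemma enorm_eq u a : 0 <= a -> (enorm u = a) <-> (dot u u = a ^+ 2).
Proof.
move=> a0; rewrite enormE; split=> [<-|->]; first by rewrite sqr_sqrtr ?dot_ge0.
by rewrite sqrtr_sqr ger0_norm.
Qed.

Lemma sphereE u : sphere u <-> dot u u = 2^-1.
Proof.
have s0 : 0 <= 1 / Num.sqrt 2 :> R by rewrite mul1r invr_ge0 sqrtr_ge0.
have -> : 2^-1 = (1 / Num.sqrt 2) ^+ 2 :> R.
  by rewrite mul1r exprVn sqr_sqrtr ?ler0n.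
exact: enorm_eq.
Qed.

(** The vectors orthogonal to the k rows of N contain a plane, and the rays
through w_0 + j w_1 for j = 0, 1, 2, ... in it are distinct; so some point on
one of them avoids the finite list s. *)
Lemma orth_point_notin k (N : 'M[R]_(k, d)) (s : seq 'rV[R]_d) :
  (k.+1 < d)%N ->
  exists x : 'rV[R]_d, [/\ x *m N^T = 0, dot x x = 2^-1 & x \notin s].
Proof.
move=> ltkd; pose B := row_base (kermx N^T).
have rB : (1 < \rank (kermx N^T))%N.
  by rewrite mxrank_ker; have := rank_leq_col N^T; lia.
pose i0 := Ordinal (ltnW rB); pose i1 := Ordinal rB.
pose w (j : nat) := row i0 B + j%:R *: row i1 B.
have free a b : a *: row i0 B + b *: row i1 B = 0 -> a = 0 /\ b = 0.
  rewrite !rowE !scalemxAl -mulmxDl => /eqP.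
  rewrite mulmx_free_eq0 ?row_base_free // => /eqP/rowP eq0.
  move: (eq0 i0) (eq0 i1); rewrite !mxE !eqxx /=.
  by rewrite !mulr0 !mulr1 addr0 add0r.
have w0 j : w j != 0.
  apply/eqP => wj; have [] := free 1 j%:R; first by rewrite scale1r.
  by move/eqP; rewrite oner_eq0.
have wker j : w j *m N^T = 0.
  have rowker i : row i B *m N^T = 0.
    by apply/sub_kermxP; rewrite -(eq_row_base (kermx N^T)) row_sub.
  by rewrite mulmxDl -scalemxAl !rowker scaler0 addr0.
pose c j := (Num.sqrt (2 * dot (w j) (w j)))^-1.
have c0 j : c j != 0.
  by rewrite invr_eq0 gt_eqF // sqrtr_gt0 mulr_gt0 ?dot_gt0 ?ltr0n.
pose x j := c j *: w j.
have xinj : injective x.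
  move=> i j /eqP; rewrite -subr_eq0 => /eqP xij.
  have [] := free (c i - c j) (c i * i%:R - c j * j%:R).
    by rewrite -xij /x /w !scalerDr !scalerBl !scalerA opprD addrACA.
  move/subr0_eq => ->; rewrite -mulrBr => /eqP.
  by rewrite mulf_eq0 (negbTE (c0 j)) /= subr_eq0 eqr_nat => /eqP.
have [[j xj]|none] := EM (exists j, x j \notin s).
  exists (x j); split=> //; first by rewrite -scalemxAl wker scaler0.
  rewrite dotZl dotZr mulrA -expr2 exprVn sqr_sqrtr ?mulr_ge0 ?dot_ge0 //.
  by rewrite invfM mulfVK // dot_eq0.
have : (size [seq x j | j <- iota 0 (size s).+1] <= size s)%N.
  apply: uniq_leq_size; first by rewrite map_inj_uniq ?iota_uniq.
  move=> y /mapP[j _ ->]; apply: contrapT => /negP xj.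
  by apply: none; exists j.
by rewrite size_map size_iota ltnn.
Qed.

(** A matrix a I + b J with a > 0 and b >= 0 is nonsingular: if v is in its kernel
then a v_j = - b S for each j, where S is the sum of the v_i, and summing over j
gives S = 0, hence v = 0.  The cases used are b = 0 (orthogonal vectors) and
a = b = 1/2 (the edges of a regular simplex from one of its vertices). *)
Lemma gram_row_free m (P : 'M[R]_(m, d)) (a b : R) : 0 < a -> 0 <= b ->
  (forall i j, dot (row i P) (row j P) = a *+ (i == j) + b) -> row_free P.
Proof.
move=> a0 b0 gram; rewrite -kermx_eq0; apply/eqP/row_matrixP => i0.
set v := row i0 _; rewrite row0.
have vP : v *m P = 0 by apply/sub_kermxP; rewrite row_sub.
clearbody v; pose S := \sum_i v 0 i.
have key j : a * v 0 j + b * S = 0.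
  have : dot (v *m P) (row j P) = 0 by rewrite vP /dot mul0mx mxE.
  rewrite mulmx_sum_row dot_suml => <-.
  under eq_bigr => i _ do rewrite dotZl gram mulrDr.
  rewrite big_split /= -mulr_suml [b * S]mulrC; congr (_ + _).
  rewrite (bigD1 j) //= eqxx mulrC big1 ?addr0 // => i ne.
  by rewrite (negbTE ne) mulr0.
have S0 : S = 0.
  have : (a + b *+ m) * S = 0.
    have : \sum_(j < m) (a * v 0 j + b * S) = 0 by rewrite big1.
    rewrite big_split /= -mulr_sumr -/S sumr_const card_ord => <-.
    by rewrite mulrDl mulrnAl.
  move/eqP; rewrite mulf_eq0 => /orP[|/eqP//].
  by rewrite gt_eqF // ltr_pwDl // mulrn_wge0.
apply/rowP => j; rewrite !mxE; have := key j; rewrite S0 mulr0 addr0 => /eqP.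
by rewrite mulf_eq0 gt_eqF //= => /eqP.
Qed.
End Dot.

Section TwoPoints.
Variables (R : realType).

(** Points with the same inner products with k independent vectors lie on a line,
which meets the sphere through them in at most two points. *)
Lemma codim1_two_points k (P : 'M[R]_(k, k.+1)) (q : 'I_3 -> 'rV[R]_k.+1) :
  row_free P -> injective q ->
  (forall i j, q i *m P^T = q j *m P^T) ->
  (forall i j, dot (q i) (q i) = dot (q j) (q j)) -> False.
Proof.
move=> freeP qinj same_dot same_norm.
pose u := q 1 - q 0; pose v := q 2%:R - q 0.
have u0 : u != 0 by rewrite subr_eq0 (inj_eq qinj).
have ker i : (q i - q 0 <= kermx P^T)%MS.
  by apply/sub_kermxP; rewrite mulmxBl (same_dot i 0) subrr.
have rk : \rank (kermx P^T) = 1%N.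
  by rewrite mxrank_ker mxrank_tr (eqnP freeP) subSnn.
have ku : (kermx P^T <= u)%MS.
  have := mxrank_leqif_sup (ker 1); rewrite -/u rk rank_rV u0.
  by move=> [_ <-].
have /sub_rVP[a va] : (v <= u)%MS by apply: submx_trans (ker _) ku.
have e1 : dot (q 0 + u) (q 0 + u) = dot (q 0) (q 0) by rewrite addrC subrK.
have e2 : dot (q 0 + v) (q 0 + v) = dot (q 0) (q 0) by rewrite addrC subrK.
have up : dot u u != 0 by rewrite dot_eq0.
move: e1 e2; rewrite va; move=> e1 e2; have {ku} uE : u = q 1 - q 0 by [].
have vE : v = q 2%:R - q 0 by [].
clearbody u v; move: e1 e2; rewrite !(dotDl, dotDr, dotZl, dotZr) (dotC u (q 0)) => e1 e2.
(* Both q 0 + u and q 0 + a u have the norm of q 0, which leaves a = 0 or a = 1. *)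
have : a * (a - 1) * dot u u = 0.
  by have := congr1 ( *%R a) e1; lra.
move/eqP; rewrite !mulf_eq0 (negbTE up) orbF => /orP[/eqP a0|].
  move: va; rewrite a0 scale0r vE => /eqP.
  by rewrite subr_eq0 (inj_eq qinj).
rewrite subr_eq0 => /eqP a1; move: va; rewrite a1 scale1r vE uE => /eqP.
by rewrite (inj_eq (addIr _)) (inj_eq qinj).
Qed.

End TwoPoints.

(** * Embeddings on the sphere *)

Section SphericalEmbedding.
Variables (R : realType) (T : finType) (d : nat).
Implicit Types (e f : rel T) (A W : {set T}) (x y : T).

(** Realization on the sphere of the subgraph induced on A. *)
Definition sph_embed e A := exists phi : T -> 'rV[R]_d,
  [/\ {in A &, injective phi},
      {in A, forall x, dot (phi x) (phi x) = 2^-1} &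
      {in A &, forall x y, e x y -> dot (phi x) (phi y) = 0}].

Lemma sph_embed_add e A x : symmetric e -> irreflexive e ->
  x \notin A -> (#|nbrs e A x|.+1 < d)%N ->
  sph_embed e A -> sph_embed e (x |: A).
Proof.
move=> e_sym e_irr xA deg_x [phi [inj nrm orth]].
pose N : 'M[R]_(#|nbrs e A x|, d) := \matrix_i phi (enum_val i).
have [q [qN q1 qs]] := orth_point_notin N [seq phi y | y in A] deg_x.
have q_orth y : y \in A -> e x y -> dot q (phi y) = 0.
  move=> yA exy; have yN : y \in nbrs e A x by rewrite in_nbrs yA.
  have /matrixP/(_ 0 (enum_rank_in yN y)) := qN.
  rewrite [RHS]mxE => <-; rewrite dotE mxE; apply: eq_bigr => i _.
  by rewrite !mxE enum_rankK_in.
have q_neq y : y \in A -> q != phi y.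
  by move=> yA; apply: contraNneq qs => ->; apply: image_f.
have off y : y \in A -> (y == x) = false.
  by move=> yA; apply: contraNF xA => /eqP <-.
exists (fun y => if y == x then q else phi y); split.
- move=> y z /setU1P[->|yA] /setU1P[->|zA]; rewrite ?eqxx ?off //.
  + by move/eqP; rewrite (negbTE (q_neq z zA)).
  + by move/eqP; rewrite eq_sym (negbTE (q_neq y yA)).
  + exact: inj.
- by move=> y /setU1P[->|yA]; rewrite ?eqxx ?off // nrm.
- move=> y z /setU1P[->|yA] /setU1P[->|zA]; rewrite ?eqxx ?off //.
  + by rewrite e_irr.
  + exact: q_orth.
  + by rewrite e_sym dotC; apply: q_orth.
  + exact: orth.
Qed.

(** Matched vertices share an axis, in opposite directions; the others get an axis
each.  Edges of f are never edges of e, so adjacent vertices lie on different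
axes. *)
Lemma matching_sph_embed e f A m : irreflexive f -> symmetric f ->
  irreflexive e ->
  (forall x y, f x y -> ~~ e x y) -> has_matching f A m ->
  (#|A| <= d + m)%N -> sph_embed e A.
Proof.
move=> f_irr f_sym e_irr fe [M [sMA [p mp] cM]] cA; have [pK pM] := mp.
have pinj := can_inj pK.
have fixp x : x \notin M -> p x = x.
  by move=> xM; apply/eqP; have := pM x; rewrite (negbTE xM).
have pA x : x \in A -> p x \in A.
  move=> xA; have [xM|/fixp ->//] := boolP (x \in M).
  by rewrite (subsetP sMA) // (matches_closed f_irr _ mp).
pose rk x : nat := enum_rank x.
have rk_inj : injective rk by move=> x y /ord_inj/enum_rank_inj.
(* One vertex for each axis: the one that comes first of a matched pair.  It gets
   the positive direction. *)
pose B := [set x in A | rk x <= rk (p x)]%N.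
have sBA : B \subset A by apply/subsetP => x; rewrite inE => /andP[].
have cB : (#|B| <= d)%N.
  have : (#|M| <= (#|A :\: B|).*2)%N.
    rewrite -addnn -{2}(card_imset (A :\: B) pinj).
    apply: leq_trans (leq_card_setU _ _).
    apply/subset_leq_card/subsetP => x xM; rewrite inE.
    have xA := subsetP sMA x xM; case: (ltngtP (rk x) (rk (p x))) => lt.
    + apply/orP; right; apply/imsetP; exists (p x); last by rewrite pK.
      by rewrite !inE pA //= pK -ltnNge lt.
    + by rewrite !inE xA /= -ltnNge lt.
    + by move/rk_inj: lt => lt; have := matches_neq f_irr mp xM; rewrite -lt eqxx.
  by rewrite cM leq_double cardsDS // => le; move: (subset_leq_card sBA); lia.
pose rep x := if x \in B then x else p x.
have repB x : x \in A -> rep x \in B.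
  move=> xA; rewrite /rep; case: ifPn => //; rewrite !inE xA /= -ltnNge pA // pK.
  exact: ltnW.
have repP x y : rep x = rep y -> [\/ x = y | x = p y].
  rewrite /rep; case: ifP => _; case: ifP => _; try by [left|right].
    by move=> <-; right; rewrite pK.
  by move/pinj; left.
pose lab x := index (rep x) (enum B).
have lab_lt x : x \in A -> (lab x < d)%N.
  move=> xA; apply: leq_trans cB; rewrite cardE index_mem mem_enum; exact: repB.
have labP x y : x \in A -> y \in A -> lab x = lab y -> [\/ x = y | x = p y].
  move=> xA yA eqlab; apply: repP.
  by rewrite -(nth_index x (s := enum B) (x := rep x)) ?mem_enum ?repB // -/(lab x)
             eqlab nth_index ?mem_enum ?repB.
pose b n : 'rV[R]_d := \row_i (i == n :> nat)%:R.
have dotb n n' : (n < d)%N -> dot (b n) (b n') = (n == n')%:R.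
  move=> ltn; rewrite dotE (bigD1 (Ordinal ltn)) //= big1 => [|i ne].
    by rewrite !mxE eqxx mul1r addr0.
  rewrite !mxE; have -> : (i == n :> nat) = false; last by rewrite mul0r.
  by apply: contraNF ne => /eqP ?; apply/eqP/val_inj.
pose c : R := Num.sqrt 2^-1.
have c2 : c * c = 2^-1 by rewrite -expr2 sqr_sqrtr // invr_ge0 ler0n.
have c0 : c != 0 by rewrite sqrtr_eq0 -ltNge invr_gt0 ltr0n.
pose s x : R := (-1) ^+ (x \notin B) * c.
exists (fun x => s x *: b (lab x)); split.
- move=> x y xA yA eqxy.
  have dotxy z : z \in A -> dot (s x *: b (lab x)) (b (lab z)) = s x * (lab x == lab z)%:R.
    by move=> zA; rewrite dotZl dotb ?lab_lt.
  have s0 z : s z != 0 by rewrite mulf_neq0 // signr_eq0.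
  have eqlab : lab x = lab y.
    apply/eqP; have := dotxy x xA; rewrite eqxy dotZl dotb ?lab_lt // eqxx mulr1.
    rewrite eq_sym; case: eqP => // _ /esym/eqP; rewrite mulr0 (negbTE (s0 x)) //.
  have eqs : s x = s y.
    have := dotxy x xA; rewrite eqxy dotZl dotb ?lab_lt // -eqlab eqxx !mulr1.
    by move=> ->.
  have [//|xpy] := labP x y xA yA eqlab.
  have [yM|/fixp pyy] := boolP (y \in M); last by rewrite xpy.
  have npy := matches_neq f_irr mp yM.
  have /signr_inj/negb_inj : (-1) ^+ (x \notin B) = (-1) ^+ (y \notin B) :> R.
    exact: (mulIf c0) eqs.
  rewrite !inE xA yA /= xpy pK.
  case: (ltngtP (rk (p y)) (rk y)) => // /rk_inj eqp.
  by rewrite eqp eqxx in npy.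
- move=> x xA; rewrite dotZl dotZr dotb ?lab_lt // eqxx mulr1 /s.
  by rewrite mulrACA -expr2 sqrr_sign mul1r.
- move=> x y xA yA exy; rewrite dotZl dotZr dotb ?lab_lt //.
  case: eqP => [eqlab|_]; last by rewrite !mulr0.
  have [eqxy|xpy] := labP x y xA yA eqlab; first by rewrite eqxy e_irr in exy.
  have [yM|/fixp pyy] := boolP (y \in M).
    have := pM y; rewrite yM f_sym -xpy => /fe; by rewrite exy.
  by rewrite xpy pyy e_irr in exy.
Qed.
End SphericalEmbedding.

(** * Realizing a graph or its complement *)

Section Euclid.
Variables (R : realType) (T : finType) (d : nat).
Implicit Types (e f : rel T) (A W : {set T}) (x y : T).

Definition euclid_embed e := exists2 phi : T -> 'rV[R]_d, injective phi &
  forall x y, e x y -> dot (phi x - phi y) (phi x - phi y) = 1.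

Lemma sph_dist (u v : 'rV[R]_d) : dot u u = 2^-1 -> dot v v = 2^-1 ->
  dot u v = 0 -> dot (u - v) (u - v) = 1.
Proof.
move=> u1 v1 uv; rewrite !(dotBl, dotBr) u1 v1 (dotC v) uv; lra.
Qed.

Lemma sph_euclid e : sph_embed R d e [set: T] -> euclid_embed e.
Proof.
case=> phi [inj nrm orth]; exists phi => [x y|x y exy]; first by apply: inj.
by apply: sph_dist; rewrite ?nrm ?orth.
Qed.

(** The d neighbours of v sit on orthogonal axes, and t S, where S is their sum,
has the same distance to all of them.  The distance is 1 for a root of
d t^2 = 2 t + 1, and then t S has squared norm t + 1/2.  For the positive root
this exceeds 1/2: the new point is off the sphere, so it meets no other. *)
Lemma off_sphere_embed e A v : symmetric e -> irreflexive e ->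
  v \notin A -> #|A| = d -> (0 < d)%N ->
  {in A &, forall x y, x != y -> e x y} ->
  (forall x, e v x -> x \in A) ->
  sph_embed R d e ([set: T] :\ v) -> euclid_embed e.
Proof.
move=> e_sym e_irr vA cA d0 cliqueA nbrv [phi [inj nrm orth]].
have off x : x != v -> x \in [set: T] :\ v by move=> xv; rewrite !inE xv.
have inA x : x \in A -> x \in [set: T] :\ v.
  by move=> xA; apply: off; apply: contraTneq xA => ->.
pose n : R := d%:R; have n0 : 0 < n by rewrite ltr0n.
pose t := (1 + Num.sqrt (1 + n)) / n.
have sq : Num.sqrt (1 + n) * Num.sqrt (1 + n) = 1 + n.
  by rewrite -expr2 sqr_sqrtr // addr_ge0 // ltW.
have t0 : 0 < t by rewrite divr_gt0 // ltr_pwDl // sqrtr_ge0.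
have tE : n * (t * t) = 2 * t + 1.
  rewrite /t; move: sq; set s := Num.sqrt _ => sq.
  have -> : n * ((1 + s) / n * ((1 + s) / n)) = (1 + 2 * s + s * s) / n.
    by field; rewrite gt_eqF.
  by rewrite sq; field; rewrite gt_eqF.
pose S := \sum_(y in A) phi y; pose q := t *: S.
have Sdot x : x \in A -> dot S (phi x) = 2^-1.
  move=> xA; rewrite dot_suml (bigD1 x) //= nrm ?inA // big1 ?addr0 //.
  by move=> y /andP[yA yx]; rewrite orth ?inA // cliqueA.
have SS : dot S S = n / 2.
  rewrite {1}/S dot_suml (eq_bigr (fun _ => 2^-1)) => [|y yA].
    by rewrite sumr_const cA mulr_natl.
  by rewrite dotC Sdot.
have qq : dot q q = t + 2^-1.
  rewrite dotZl dotZr SS; lra.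
have qx x : x \in A -> dot (q - phi x) (q - phi x) = 1.
  move=> xA; rewrite !(dotBl, dotBr) qq nrm ?inA // (dotC (phi x)).
  by rewrite dotZl Sdot //; lra.
have q_neq x : x != v -> q != phi x.
  move=> xv; apply/eqP => eqq; have := qq; rewrite eqq nrm ?off //; lra.
exists (fun x => if x == v then q else phi x).
  move=> x y; case: eqVneq => [->|xv]; case: eqVneq => [->|yv] //.
  - by move/eqP; rewrite (negbTE (q_neq _ yv)).
  - by move/eqP; rewrite eq_sym (negbTE (q_neq _ xv)).
  - by apply: inj; apply: off.
move=> x y; case: eqVneq => [->|xv]; case: eqVneq => [->|yv] //.
- by rewrite e_irr.
- by move/nbrv/qx.
- rewrite e_sym => /nbrv/qx; by rewrite !(dotBl, dotBr) (dotC q (phi x)); lra.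
- by move=> exy; apply: sph_dist; rewrite ?nrm ?orth ?off.
Qed.

End Euclid.

Section Ramsey.
Variables (R : realType) (T : finType) (k : nat).
Implicit Types (e f : rel T) (A W H K : {set T}) (x y : T).

Definition min_deg e H := forall x, x \in H -> (k <= #|nbrs e H x|)%N.

Lemma card_nbrsI e H K x :
  (#|nbrs e H x| <= #|nbrs e (H :&: K) x| + #|H :\: K|)%N.
Proof.
apply: leq_trans (leq_card_setU _ _).
apply/subset_leq_card/subsetP => y; rewrite !inE => /andP[-> ->].
by case: (y \in K).
Qed.

Lemma has_matching0 e A : has_matching e A 0.
Proof. by exists set0; rewrite sub0set cards0; split=> //; apply: matched0. Qed.

Lemma has_matchingS e A W m : A \subset W -> has_matching e A m -> has_matching e W m.
Proof.
by move=> sAW [M [sM mM cM]]; exists M; split=> //; apply: subset_trans sM sAW.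
Qed.

(** H and K stand for the k-cores of the complementary relations e and f.  On W,
which lies in both, the degrees for e and f are at least k - |H \ K| and
k - |K \ H|, while they add up to |W| - 1. *)
Section Cores.
Variables (e f : rel T) (H K : {set T}).
Hypotheses (e_sym : symmetric e) (e_irr : irreflexive e) (f_irr : irreflexive f).
Hypothesis fe : forall x y, x != y -> f x y = ~~ e x y.
Hypotheses (degH : min_deg e H) (degK : min_deg f K).
Hypothesis leKH : (#|K :\: H| <= #|H :\: K|)%N.
Let W := H :&: K.

Let cH : #|H| = (#|W| + #|H :\: K|)%N.
Proof. by rewrite cardsID. Qed.
Let cK : #|K| = (#|W| + #|K :\: H|)%N.
Proof. by rewrite /W setIC cardsID. Qed.
Let cHK : #|H :|: K| = (#|W| + #|H :\: K| + #|K :\: H|)%N.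
Proof. by have := cardsUI H K; rewrite -/W; move: cH cK; lia. Qed.

Let f_sym : symmetric f := compl_sym e_sym f_irr fe.

Let degeW x : x \in W -> (k <= #|nbrs e W x| + #|H :\: K|)%N.
Proof.
by rewrite inE => /andP[/degH + _] => /leq_trans; apply; apply: card_nbrsI.
Qed.
Let degfW x : x \in W -> (k <= #|nbrs f W x| + #|K :\: H|)%N.
Proof.
rewrite inE => /andP[_ /degK] => /leq_trans; apply.
by rewrite /W setIC; apply: card_nbrsI.
Qed.
Let degW x : x \in W -> (#|nbrs e W x| + #|nbrs f W x| = #|W|.-1)%N.
Proof. exact: card_nbrs_compl. Qed.

Let embedK m : has_matching e W m -> (#|K| <= k.+1 + m)%N -> sph_embed R k.+1 f K.
Proof.
move=> /(has_matchingS (subsetIr H K)) mK cK'.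
apply: (matching_sph_embed _ e_irr e_sym f_irr _ mK) => //.
move=> x y exy; rewrite fe ?exy //.
by apply: contraTneq exy => ->; rewrite e_irr.
Qed.

Let embedH m : has_matching f W m -> (#|H| <= k.+1 + m)%N -> sph_embed R k.+1 e H.
Proof.
move=> /(has_matchingS (subsetIl H K)) mH cH'.
apply: (matching_sph_embed _ f_irr f_sym e_irr _ mH) => //.
move=> x y fxy; rewrite -fe ?fxy //.
by apply: contraTneq fxy => ->; rewrite f_irr.
Qed.

(** The degree bounds on a vertex of W force |H u K| = 2k + 1 unless W is empty.
Then |W| = 2k + 1 - h - |K \ H| >= 2(k - h) with h = |H \ K|, so e has a matching
of size k - h on W, and |K| = 2k + 1 - h = (k + 1) + (k - h).  If h > k or W is
empty, then |K| <= k and every vertex of K gets its own axis. *)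
Lemma odd_cores_embed : (#|H :|: K| <= k.*2.+1)%N -> sph_embed R k.+1 f K.
Proof.
move=> cU; have [W0|[v vW]] := set_0Vmem W.
  apply: embedK (has_matching0 _ _) _.
  by move: cU leKH; rewrite cHK cK W0 cards0; clear; lia.
have cW : (k.*2.+1 <= #|H :|: K|)%N.
  have : (0 < #|W|)%N by apply/card_gt0P; exists v.
  by move: (degeW vW) (degfW vW) (degW vW); rewrite cHK; clear; lia.
apply: (@embedK (k - #|H :\: K|)%N).
  apply: (mindeg_matching _ _ (r := (k - #|H :\: K|)%N)) => //.
    by move=> x /degeW; clear; lia.
  by move: cW leKH; rewrite cHK; clear; lia.
by move: cU cW; rewrite cHK cK; clear; lia.
Qed.

(** Let h = |H \ K|; if h > k then |K| <= k + 1 and every vertex of K gets its own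
axis.  Otherwise put r = k - h and a' = k + 1 - |K \ H|: the first two cases of
[near_regular_matching] give the matchings that K and H need.  In the third,
h = k and |K| = k + 2, so a single e-edge within K would suffice to embed K.
Otherwise f is complete on K; and a vertex v of W, having no e-neighbour in W,
needs all k vertices of H outside K as e-neighbours, hence has no f-neighbour
there. *)
Lemma even_cores_embed : #|H :|: K| = k.+1.*2 ->
  [\/ sph_embed R k.+1 f K, sph_embed R k.+1 e H |
   [/\ #|K| = k.+2, {in K &, forall x y, x != y -> f x y} &
    exists2 v, v \in K & forall x, x \in H :|: K -> f v x -> x \in K]].
Proof.
move=> cU.
have [lekh|lthk] := leqP k.+1 #|H :\: K|.
  constructor 1; apply: embedK (has_matching0 _ _) _.
  by move: cU lekh; rewrite cHK cK; clear; lia.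
have cW : #|W| = ((k - #|H :\: K|).+1 + (k.+1 - #|K :\: H|))%N.
  by move: cU lthk leKH; rewrite cHK; clear; lia.
have [||m1|[eqa mf]|[r0 indep]] := @near_regular_matching _ e f W _ _ e_sym e_irr f_irr fe _ _ cW.
- move=> x xW; move: (degeW xW) (degfW xW) (degW xW) lthk leKH; rewrite cW.
  by clear; lia.
- by move: lthk leKH; clear; lia.
- by constructor 1; apply: embedK m1 _; move: cU lthk; rewrite cHK cK; clear; lia.
- by constructor 2; apply: embedH mf _; move: cU lthk leKH; rewrite cHK cH; clear; lia.
have hk : #|H :\: K| = k by move: r0 lthk; clear; lia.
have cK2 : #|K| = k.+2 by move: cU; rewrite cHK cK hk; clear; lia.
have [[x [y [xK yK exy]]]|noe] := EM (exists x y, [/\ x \in K, y \in K & e x y]).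
  constructor 1.
  have xy : x != y by apply: contraTneq exy => ->; rewrite e_irr.
  apply: (@matching_sph_embed _ _ _ f e K 1) => //.
  + by move=> z t ezt; rewrite fe ?ezt //; apply: contraTneq ezt => ->; rewrite e_irr.
  + exists (x |: (y |: set0)); split.
    * by rewrite !subUset !sub1set sub0set xK yK.
    * by apply: matched_add; rewrite ?inE //; apply: matched0.
    * by rewrite !cardsU1 !inE cards0 (negbTE xy).
  + by rewrite cK2 addn1.
constructor 3; split=> //.
  move=> x y xK yK xy; rewrite fe //; apply/negP => exy.
  by apply: noe; exists x, y.
have [W0|[v vW]] := set_0Vmem W.
  by move: cW leKH; rewrite W0 cards0 hk; clear; lia.
exists v; first by move: vW; rewrite inE => /andP[].
move=> x; have [//|xK] := boolP (x \in K); rewrite in_setU (negbTE xK) orbF => xH.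
have sub : nbrs e H v \subset H :\: K.
  apply/subsetP => y; rewrite in_nbrs in_setD => /andP[yH evy].
  rewrite yH andbT; apply: contraTN evy => yK.
  by apply: indep => //; rewrite inE yH.
have vH : v \in H by move: vW; rewrite inE => /andP[].
have /eqP E : nbrs e H v == H :\: K by rewrite eqEcard sub hk degH.
have : x \in nbrs e H v by rewrite E inE xK.
rewrite in_nbrs => /andP[_ evx]; rewrite fe ?evx //.
by apply: contraTneq evx => ->; rewrite e_irr.
Qed.

End Cores.

(** The vertices outside K are peeled off as before, but in the graph without v.
What is left of the core is a clique on d = k + 1 vertices. *)
Lemma clique_core_euclid f K v :
  symmetric f -> irreflexive f ->
  (forall P : {set T} -> Prop,
     (forall (B : {set T}) x, x \notin B -> (#|nbrs f B x| < k)%N -> P B -> P (x |: B)) ->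
     P K -> P [set: T]) ->
  #|K| = k.+2 -> {in K &, forall x y, x != y -> f x y} -> v \in K ->
  (forall x, f v x -> x \in K) -> euclid_embed R k.+1 f.
Proof.
move=> f_sym f_irr peelK cK cliqueK vK nbrv.
have cKv : #|K :\ v| = k.+1 by have := cardsD1 v K; rewrite cK vK => -[].
apply: (@off_sphere_embed R T k.+1 f (K :\ v) v) => //.
- by rewrite !inE eqxx.
- move=> x y; rewrite !inE => /andP[_ xK] /andP[_ yK]; exact: cliqueK.
- move=> x fvx; rewrite !inE nbrv // andbT.
  by apply: contraTneq fvx => ->; rewrite f_irr.
apply: (peelK (fun B => sph_embed R k.+1 f (B :\ v))).
  move=> B x xB degx embB; have [->|xv] := eqVneq x v.
    by rewrite (_ : (v |: B) :\ v = B :\ v) //; apply/setP => y; rewrite !inE; case: eqP.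
  rewrite (_ : (x |: B) :\ v = x |: (B :\ v)); last first.
    apply/setP => y; rewrite !inE; have [->|//] := eqVneq y x.
    by rewrite xv.
  apply: sph_embed_add => //; first by rewrite !inE (negbTE xB) andbF.
  by apply: leq_ltn_trans degx; apply/subset_leq_card/nbrsS/subD1set.
apply: (@matching_sph_embed R T k.+1 f (fun _ _ => false) _ 0) => //.
- exact: has_matching0.
- by rewrite cKv addn0.
Qed.

Section Main.
Variables (e f : rel T).
Hypotheses (e_sym : symmetric e) (e_irr : irreflexive e) (f_irr : irreflexive f).
Hypothesis fe : forall x y, x != y -> f x y = ~~ e x y.

Let f_sym : symmetric f := compl_sym e_sym f_irr fe.
Let ef x y : x != y -> e x y = ~~ f x y.
Proof. by move=> xy; rewrite fe // negbK. Qed.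

Lemma sph_embed_or_compl : (#|T| <= k.*2.+1)%N ->
  sph_embed R k.+1 e [set: T] \/ sph_embed R k.+1 f [set: T].
Proof.
move=> cT; have cU (A : {set T}) : (#|A| <= k.*2.+1)%N := leq_trans (max_card _) cT.
have [H [_ degH peelH]] := peeling e k [set: T].
have [K [_ degK peelK]] := peeling f k [set: T].
have [le|le] := leqP #|K :\: H| #|H :\: K|; [right; apply: peelK|left; apply: peelH].
- by move=> B x xB degx; apply: sph_embed_add.
- exact: (odd_cores_embed e_sym e_irr f_irr fe degH degK le (cU _)).
- by move=> B x xB degx; apply: sph_embed_add.
- exact: (odd_cores_embed f_sym f_irr e_irr ef degK degH (ltnW le) (cU _)).
Qed.

Lemma euclid_embed_or_compl : (#|T| <= k.+1.*2)%N ->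
  euclid_embed R k.+1 e \/ euclid_embed R k.+1 f.
Proof.
move=> cT.
have [H [_ degH peelH]] := peeling e k [set: T].
have [K [_ degK peelK]] := peeling f k [set: T].
have addE (B : {set T}) x : x \notin B -> (#|nbrs e B x| < k)%N ->
  sph_embed R k.+1 e B -> sph_embed R k.+1 e (x |: B).
  by move=> xB degx; apply: sph_embed_add.
have addF (B : {set T}) x : x \notin B -> (#|nbrs f B x| < k)%N ->
  sph_embed R k.+1 f B -> sph_embed R k.+1 f (x |: B).
  by move=> xB degx; apply: sph_embed_add.
have embE : sph_embed R k.+1 e H -> euclid_embed R k.+1 e.
  by move=> embH; apply/sph_euclid/(peelH _ addE).
have embF : sph_embed R k.+1 f K -> euclid_embed R k.+1 f.
  by move=> embK; apply/sph_euclid/(peelK _ addF).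
have [small|big] := leqP #|H :|: K| k.*2.+1.
  have [le|le] := leqP #|K :\: H| #|H :\: K|.
    by right; apply/embF/(odd_cores_embed e_sym e_irr f_irr fe degH degK le).
  left; apply/embE/(odd_cores_embed f_sym f_irr e_irr ef degK degH (ltnW le)).
  by rewrite setUC.
have cU : #|H :|: K| = k.+1.*2.
  by apply/eqP; rewrite eqn_leq (leq_trans (max_card _) cT) doubleS.
have UT : H :|: K = setT.
  by apply/eqP; rewrite eqEcard subsetT cardsT cU.
have [le|le] := leqP #|K :\: H| #|H :\: K|.
  have [/embF|/embE|] := even_cores_embed e_sym e_irr f_irr fe degH degK le cU.
  - by right.
  - by left.
  case=> cK cliqueK [v vK nbrv]; right.
  apply: (clique_core_euclid f_sym f_irr peelK cK cliqueK vK) => x.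
  by apply: nbrv; rewrite UT inE.
rewrite setUC in cU.
have [/embE|/embF|] := even_cores_embed f_sym f_irr e_irr ef degK degH (ltnW le) cU.
- by left.
- by right.
case=> cH cliqueH [v vH nbrv]; left.
apply: (clique_core_euclid e_sym e_irr peelH cH cliqueH vH) => x.
by apply: nbrv; rewrite setUC UT inE.
Qed.
End Main.
End Ramsey.

Section Upper.
Variables (R : realType).

Lemma sph_unit_distance (T : finType) (G : sgraph T) d :
  sph_embed R d G [set: T] -> unit_distance_in (@sphere R d) G.
Proof.
case=> phi [inj nrm orth]; exists phi; split=> [x y|x|x y Gxy].
- exact: inj.
- by apply/sphereE; apply: nrm.
- by rewrite (enorm_eq _ ler01) expr1n sph_dist ?nrm ?orth.
Qed.

Lemma euclid_unit_distance (T : finType) (G : sgraph T) d :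
  euclid_embed R d G -> unit_distance_in (@classical_sets.setT 'rV[R]_d) G.
Proof.
case=> phi inj dist; exists phi; split=> // x y Gxy.
by rewrite (enorm_eq _ ler01) expr1n dist.
Qed.

Lemma ramsey_sphere k s : (s <= k.*2.+1)%N -> ramsey_in (@sphere R k.+1) s.
Proof.
move=> les V G cV.
have [|||||/sph_unit_distance|/sph_unit_distance] :=
  @sph_embed_or_compl R V k G (complement G); try by [left|right].
- exact: edge_sym.
- exact: edge_irrefl.
- exact: edge_irrefl.
- by move=> x y xy; rewrite /= /compl_edge xy.
- by rewrite cV.
Qed.

Lemma ramsey_euclid k s : (s <= k.+1.*2)%N -> ramsey_in (@classical_sets.setT 'rV[R]_k.+1) s.
Proof.
move=> les V G cV.
have [|||||/euclid_unit_distance|/euclid_unit_distance] :=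
  @euclid_embed_or_compl R V k G (complement G); try by [left|right].
- exact: edge_sym.
- exact: edge_irrefl.
- exact: edge_irrefl.
- by move=> x y xy; rewrite /= /compl_edge xy.
- by rewrite cV.
Qed.

End Upper.

(** * Graphs that are not realizable, nor their complements *)

Section Lower.
Variables (R : realType).

(** The graph used for both lower bounds: a clique on the vertices t, t + 1, ...,
the t others being isolated. *)
Definition tail_clique_edge s t : rel 'I_s :=
  fun x y => [&& x != y, (t <= x)%N & (t <= y)%N].

Lemma tail_clique_edge_sym s t : symmetric (@tail_clique_edge s t).
Proof. by move=> x y; rewrite /tail_clique_edge eq_sym [in RHS]andbA [in RHS]andbAC andbA. Qed.

Lemma tail_clique_edge_irrefl s t : irreflexive (@tail_clique_edge s t).
Proof. by move=> x; rewrite /tail_clique_edge eqxx. Qed.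

Definition tail_clique s t : sgraph 'I_s :=
  SGraph (@tail_clique_edge_sym s t) (@tail_clique_edge_irrefl s t).

(** Points are indexed by natural numbers to allow arithmetic on vertices.  The two
alternatives correspond to the graph and to its complement. *)
Lemma tail_clique_points d (X : classical_sets.set 'rV[R]_d) s t :
  (0 < s)%N -> ramsey_in X s ->
  exists psi : nat -> 'rV[R]_d,
    [/\ forall i j, (i < s)%N -> (j < s)%N -> psi i = psi j -> i = j,
        forall i, (i < s)%N -> X (psi i) &
        (forall i j, (t <= i < s)%N -> (t <= j < s)%N -> i != j ->
           dot (psi i - psi j) (psi i - psi j) = 1) \/
        (forall i j, (i < t)%N -> (i < j < s)%N ->
           dot (psi i - psi j) (psi i - psi j) = 1)].
Proof.
case: s => // s _ /(_ _ (tail_clique s.+1 t) (card_ord _)).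
have neq i j : (i < s.+1)%N -> (j < s.+1)%N -> i != j -> inord i != inord j :> 'I_s.+1.
  by move=> lti ltj; apply: contraNneq => eqij; rewrite -(inordK lti) eqij inordK.
case=> -[phi [inj Xphi dist]]; exists (phi \o inord); split=> [i j lti ltj|i _|].
- by move/inj => eqij; rewrite -(inordK lti) eqij inordK.
- exact: Xphi.
- left=> i j /andP[ti lti] /andP[tj ltj] ij.
  have := dist (inord i) (inord j); rewrite (enorm_eq _ ler01) expr1n; apply.
  by rewrite /= /tail_clique_edge neq // !inordK // ti tj.
- by move/inj => eqij; rewrite -(inordK lti) eqij inordK.
- exact: Xphi.
- right=> i j it /andP[ij ltj]; have lti := ltn_trans ij ltj.
  have := dist (inord i) (inord j); rewrite (enorm_eq _ ler01) expr1n; apply.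
  rewrite /= /compl_edge /= /tail_clique_edge neq ?neq_ltn ?ij //=.
  by rewrite !inordK // leqNgt it.
Qed.

Lemma row_free_leq m d (P : 'M[R]_(m, d)) : row_free P -> (m <= d)%N.
Proof. by move/eqP <-; apply: rank_leq_col. Qed.

Lemma sphere_orth d (u v : 'rV[R]_d) : dot u u = 2^-1 -> dot v v = 2^-1 ->
  dot (u - v) (u - v) = 1 -> dot u v = 0.
Proof. by move=> u1 v1; rewrite !(dotBl, dotBr) u1 v1 (dotC v); lra. Qed.

Lemma unit_dot d (u v : 'rV[R]_d) : dot u u = 1 -> dot v v = 1 ->
  dot (u - v) (u - v) = 1 -> dot u v = 2^-1.
Proof. by move=> u1 v1; rewrite !(dotBl, dotBr) u1 v1 (dotC v); lra. Qed.

(** Take t = k.  The bound 2 < s supplies three vertices outside the first k also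
when k = 0. *)
Lemma not_ramsey_sphere k s : (k.+1.*2 <= s)%N -> (2 < s)%N ->
  ~ ramsey_in (@sphere R k.+1) s.
Proof.
move=> ks s2 /(tail_clique_points k (ltnW (ltnW s2))) [psi [inj nrm]].
have {}nrm i : (i < s)%N -> dot (psi i) (psi i) = 2^-1 by move/nrm/sphereE.
have h0 : 0 < 2^-1 :> R by rewrite invr_gt0 ltr0n.
case=> dist.
  pose P : 'M[R]_(k.+2, k.+1) := \matrix_(i < k.+2) psi (k + i)%N.
  have lts (i : 'I_k.+2) : (k + i < s)%N by have := ltn_ord i; lia.
  suff /row_free_leq : row_free P by rewrite ltnn.
  apply: (gram_row_free h0 (lexx 0)) => i j; rewrite addr0 !rowK.
  case: eqVneq => [->|ij]; first by rewrite nrm.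
  by apply: sphere_orth; rewrite ?nrm ?dist ?eqn_add2l // leq_addr lts.
pose P : 'M[R]_(k, k.+1) := \matrix_(i < k) psi i.
have lts (i : 'I_k) : (i < s)%N by have := ltn_ord i; lia.
have ltq (i : 'I_3) : (k + i < s)%N by have := ltn_ord i; lia.
pose q (i : 'I_3) := psi (k + i)%N.
have freeP : row_free P.
  apply: (gram_row_free h0 (lexx 0)) => i j; rewrite addr0 !rowK.
  case: eqVneq => [->|ij]; first by rewrite nrm.
  wlog ltij : i j ij / (i < j)%N => [hw|].
    by have := ij; rewrite neq_ltn => /orP[/hw->|/hw]; rewrite // dotC => ->; rewrite // eq_sym.
  by apply: sphere_orth; rewrite ?nrm ?dist // ltij lts.
have qP i : q i *m P^T = 0.
  apply/rowP => j; rewrite [RHS]mxE.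
  have <- : dot (q i) (row j P) = (q i *m P^T) 0 j.
    by rewrite dotE mxE; apply: eq_bigr => l _; rewrite !mxE.
  rewrite rowK dotC; apply: sphere_orth; rewrite ?nrm ?dist // ltq.
  by rewrite (leq_trans (ltn_ord j)) // leq_addr.
apply: (codim1_two_points freeP (q := q)) => [i j|i j|i j].
- by move/inj => /(_ (ltq _) (ltq _)) /addnI /val_inj.
- by rewrite !qP.
- by rewrite !nrm.
Qed.

(** Take t = k + 1, and move the origin to a vertex of the clique, or to vertex 0
in the case of the complement.  The vectors considered then have norm 1 and
inner products 1/2. *)
Lemma not_ramsey_euclid k s : (k.+2.*2 <= s)%N ->
  ~ ramsey_in (@classical_sets.setT 'rV[R]_k.+1) s.
Proof.
move=> ks; have s0 : (0 < s)%N by lia.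
move=> /(tail_clique_points k.+1 s0) [psi [inj _]].
have h0 : 0 < 2^-1 :> R by rewrite invr_gt0 ltr0n.
have half : 2^-1 + 2^-1 = 1 :> R by lra.
case=> dist.
  pose p (i : 'I_k.+2) := psi (k.+2 + i)%N - psi k.+1.
  have lts (i : 'I_k.+2) : (k.+1 <= k.+2 + i < s)%N by have := ltn_ord i; lia.
  have nrm i : dot (p i) (p i) = 1 by apply: dist => //; lia.
  pose P : 'M[R]_(k.+2, k.+1) := \matrix_(i < k.+2) p i.
  suff /row_free_leq : row_free P by rewrite ltnn.
  apply: (gram_row_free h0 (ltW h0)) => i j; rewrite !rowK.
  case: eqVneq => [->|ij]; first by rewrite nrm half.
  rewrite add0r; apply: unit_dot => //.
  by rewrite /p opprB addrA subrK dist // eqn_add2l.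
pose p (i : 'I_k) := psi i.+1 - psi 0%N.
have lts (i : 'I_k) : (i.+1 < k.+1)%N by rewrite ltnS.
have sym i j : dot (psi i - psi j) (psi i - psi j) = dot (psi j - psi i) (psi j - psi i).
  by rewrite !(dotBl, dotBr); lra.
have nrm i : dot (p i) (p i) = 1 by rewrite sym dist //; have := lts i; lia.
pose P : 'M[R]_(k, k.+1) := \matrix_(i < k) p i.
pose q (i : 'I_3) := psi (k.+1 + i)%N - psi 0%N.
have ltq (i : 'I_3) : (k.+1 + i < s)%N by have := ltn_ord i; lia.
have nrmq i : dot (q i) (q i) = 1 by rewrite sym dist // ltq.
have freeP : row_free P.
  apply: (gram_row_free h0 (ltW h0)) => i j; rewrite !rowK.
  case: eqVneq => [->|ij]; first by rewrite nrm half.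
  wlog ltij : i j ij / (i < j)%N => [hw|].
    by have := ij; rewrite neq_ltn => /orP[/hw->|/hw]; rewrite // dotC => ->; rewrite // eq_sym.
  rewrite add0r; apply: unit_dot => //.
  by rewrite /p opprB addrA subrK dist //; have := lts j; lia.
have qP i j : dot (q i) (p j) = 2^-1.
  rewrite dotC; apply: unit_dot => //.
  by rewrite /p opprB addrA subrK dist //; have := lts j; have := ltq i; lia.
apply: (codim1_two_points freeP (q := q)) => [i j|i i'|i j].
- by move/addIr/inj => /(_ (ltq _) (ltq _)) /addnI /val_inj.
- apply/rowP => j.
  have E l : (q l *m P^T) 0 j = dot (q l) (row j P).
    by rewrite dotE mxE; apply: eq_bigr => n _; rewrite !mxE.
  by rewrite !E rowK !qP.
- by rewrite !nrmq.
Qed.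
End Lower.

Local Close Scope ring_scope.

(* uphalf n is the ceiling of n / 2; for s = 2 one has f_SD R s = 1, not 2 *)
Theorem theorem4 (R : realType) (s : nat) (hs : 1 <= s) :
  (s != 2 -> f_SD R s = uphalf (s + 1)) /\
  uphalf (s - 1) <= f_D R s <= uphalf s.
Proof.
split=> [s2|].
  rewrite /f_SD; case: ex_minnP => -[//|k] /andP[_ /asboolP ram] minram.
  apply/eqP; rewrite eqn_leq; apply/andP; split.
    have [m hm] : exists m, uphalf (s + 1) = m.+1 by exists (uphalf (s + 1)).-1; lia.
    by rewrite hm; apply: minram; apply/andP; split=> //; apply/asboolP/ramsey_sphere; lia.
  rewrite leqNgt; apply/negP => lt; apply: not_ramsey_sphere ram; lia.
rewrite /f_D; case: ex_minnP => -[//|k] /andP[_ /asboolP ram] minram.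
apply/andP; split.
  by rewrite leqNgt; apply/negP => lt; apply: not_ramsey_euclid ram; lia.
have [m hm] : exists m, uphalf s = m.+1 by exists (uphalf s).-1; lia.
by rewrite hm; apply: minram; apply/andP; split=> //; apply/asboolP/ramsey_euclid; lia.
Qed.
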